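(* If $G$ is a weighted graph, then the Jacobian group $J(G)$ is finite if and only if the edges of each maximal $2$-connected subgraph of $G$ are commensurable.
   Context: A weighted graph $G$ is a finite connected multigraph (loops and multiple edges allowed) with nonempty finite vertex set $V(G)$, finite edge set $E(G)$, a length function $\ell : E(G) \to \mathbb{R}_{>0}$, and a fixed orientation: each edge $e$ has a tail $e^-$ and a head $e^+$. For $A \in \{\mathbb{Z},\mathbb{R}\}$, $C_1(G,A)$ is the free $A$-module on $E(G)$. Let $(d^*\alpha)(x) = \sum_{e : e^+ = x}\alpha(e) - \sum_{e : e^-=x}\alpha(e)$ and $H_1(G,\mathbb{Z}) = \ker(d^* )\cap C_1(G,\mathbb{Z})$. A 1-form $\omega = \sum_e \omega_e\, de$ (formal real combination of symbols $de$, $e\in E(G)$) is harmonic if $\sum_{e: e^+=x}\omega_e = \sum_{e : e^-=x}\omega_e$ for all $x \in V(G)$; $\Omega(G)$ is the space of harmonic 1-forms. Integration is bilinear with $\int_{e'} de = \ell(e)$ if $e=e'$ and $0$ otherwise; each $\alpha\in C_1(G,\mathbb{R})$ gives $\int_\alpha \in \Omega(G)^*$. Put $\Omega(G)^\sharp = \{\int_\alpha : \alpha \in C_1(G,\mathbb{Z})\}$. The map $\alpha\mapsto\int_\alpha$ embeds $H_1(G,\mathbb{Z})$ in $\Omega(G)^\sharp$, and the Jacobian is $J(G) = \Omega(G)^\sharp / H_1(G,\mathbb{Z})$. A weighted graph is $2$-connected if its geometric realization (obtained by gluing segments $[0,\ell(e)]$ according to the endpoints of the edges) cannot be disconnected by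 deleting a single point. (So a single non-loop edge is not $2$-connected, while a single loop is.) Positive reals $a_1,\dots,a_n$ are commensurable if $a_i/a_j\in\mathbb{Q}$ for all $i,j$; a collection of edges is commensurable if their lengths are. *)

(* Defs.v *)
From HB Require Import structures.
From mathcomp Require Import all_boot all_order all_algebra ring_quotient.
From mathcomp Require Import all_classical reals topology normedtype.

Set Implicit Arguments.
Unset Strict Implicit.
Unset Printing Implicit Defensive.

Import Order.TTheory GRing.Theory Num.Theory.
Import numFieldNormedType.Exports.

Local Open Scope classical_set_scope.
Local Open Scope ring_scope.

Record wmgraph (R : realType) := WMGraph {
  vertex : finType;
  edge : finType;
  tail : edge -> vertex;
  head : edge -> vertex;
  len : edge -> R;
  len_gt0 : forall e, 0 < len e }.

Arguments tail {R w} e.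
Arguments head {R w} e.
Arguments len {R w} e.

Definition adjacent (R : realType) (G : wmgraph R) : rel (vertex G) :=
  [rel x y | [exists e : edge G, ((tail e == x) && (head e == y))
                              || ((tail e == y) && (head e == x))]].

Definition weighted_graph (R : realType) (G : wmgraph R) : Prop :=
  (0 < #|vertex G|)%N /\ forall x y : vertex G, connect (@adjacent R G) x y.

Notation C1 G A := {ffun edge G -> A}.

Definition codiff (R : realType) (G : wmgraph R) (A : zmodType)
    (a : C1 G A) : {ffun vertex G -> A} :=
  [ffun x => \sum_(e | head e == x) a e - \sum_(e | tail e == x) a e].

Lemma codiffB (R : realType) (G : wmgraph R) (A : zmodType) (a b : C1 G A) :
  codiff (a - b) = codiff a - codiff b.
Proof.
have sB (P : pred (edge G)) : \sum_(e | P e) (a - b) e =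
    \sum_(e | P e) a e - \sum_(e | P e) b e.
  by rewrite -sumrB; apply: eq_bigr => e _; rewrite !ffunE.
apply/ffunP => x; rewrite !ffunE !sB !opprB addrACA.
by rewrite [X in _ + X]addrC addrACA.
Qed.

Section Jacobian.
Variables (R : realType) (G : wmgraph R).

(* A 1-form is given by its coefficients.  *)
Notation form := {ffun edge G -> R^o}.

Fact codiff_is_linear :
  linear (@codiff R G R^o : form -> {ffun vertex G -> R^o}).
Proof.
move=> k a b; apply/ffunP => x; rewrite !ffunE scalerBr !scaler_sumr.
rewrite addrACA -opprD -!big_split /=.
by congr (_ - _); apply: eq_bigr => e _; rewrite !ffunE.
Qed.

HB.instance Definition _ := GRing.isLinear.Build R form
  {ffun vertex G -> R^o} _ (@codiff R G R^o) codiff_is_linear.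

(* Harmonicity is the vanishing of codiff on the coefficients, see OmegaP. *)
Definition Omega : {vspace form} := lker (linfun (@codiff R G R^o)).

Lemma OmegaP (w : form) :
  reflect (forall x : vertex G,
             \sum_(e | head e == x) w e = \sum_(e | tail e == x) w e)
          (w \in Omega).
Proof.
rewrite memv_ker lfunE /=; apply: (iffP eqP) => [/ffunP H x|H].
  by have := H x; rewrite !ffunE => /eqP; rewrite subr_eq0 => /eqP.
by apply/ffunP => x; rewrite !ffunE H subrr.
Qed.

Definition Omega_dual := 'Hom(subvs_of Omega, R^o).
HB.instance Definition _ := GRing.Zmodule.on Omega_dual.

(* Bilinear extension of: the integral of de' along e is len e if e = e', *)
(* and 0 otherwise.                                                       *)
Definition form_integral (a : C1 G R) (w : form) : R :=
  \sum_e a e * w e * len e.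

Definition integral_Omega (a : C1 G R) (w : subvs_of Omega) : R^o :=
  form_integral a (vsval w).

Fact integral_Omega_is_linear (a : C1 G R) : linear (integral_Omega a).
Proof.
move=> k u v; rewrite /integral_Omega /form_integral scaler_sumr -big_split /=.
apply: eq_bigr => e _; rewrite !ffunE /=.
by rewrite mulrDr mulrDl -[k *: _]/(k * _) -[k *: _]/(k * _) -!mulrA mulrCA.
Qed.

HB.instance Definition _ (a : C1 G R) := GRing.isLinear.Build R
  (subvs_of Omega) R^o _ (integral_Omega a) (integral_Omega_is_linear a).

Definition int_along (a : C1 G R) : Omega_dual := linfun (integral_Omega a).

Lemma int_alongE (a : C1 G R) (w : subvs_of Omega) :
  int_along a w = form_integral a (vsval w).
Proof. by rewrite lfunE. Qed.

Lemma int_alongB (a b : C1 G R) :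
  int_along (a - b) = int_along a - int_along b.
Proof.
apply/lfunP => w; rewrite add_lfunE opp_lfunE !int_alongE /form_integral -sumrB.
by apply: eq_bigr => e _; rewrite !ffunE /= !mulrBl.
Qed.

Definition chainR (a : C1 G int) : C1 G R := [ffun e => (a e)%:~R].

Lemma chainRB (a b : C1 G int) : chainR (a - b) = chainR a - chainR b.
Proof. by apply/ffunP => e; rewrite !ffunE rmorphB. Qed.

Definition H1Z : set (C1 G int) := [set a | codiff a = 0].

Definition Omega_sharp_pred : {pred Omega_dual} :=
  [pred f | f \in range (int_along \o chainR)].

Fact Omega_sharp_zmod_closed : zmod_closed Omega_sharp_pred.
Proof.
split=> [|f g]; rewrite !inE.
  exists 0 => //=; rewrite -[in LHS](subrr 0) chainRB int_alongB.
  by rewrite subrr.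
move=> [a _ <-] [b _ <-]; exists (a - b) => //=.
by rewrite chainRB int_alongB.
Qed.

HB.instance Definition _ := GRing.isZmodClosed.Build Omega_dual
  Omega_sharp_pred Omega_sharp_zmod_closed.

Definition Omega_sharp := {f : Omega_dual | f \in Omega_sharp_pred}.
HB.instance Definition _ := Choice.on Omega_sharp.
HB.instance Definition _ := SubType.on Omega_sharp.
HB.instance Definition _ := [SubChoice_isSubZmodule of Omega_sharp by <:].

(* The image of H1Z under its embedding in Omega_sharp. *)
Definition H1_pred : {pred Omega_sharp} :=
  [pred f | val f \in (int_along \o chainR) @` H1Z].

Fact H1_zmod_closed : zmod_closed H1_pred.
Proof.
split=> [|f g]; rewrite !inE /=.
  exists 0; first by apply/ffunP => x; rewrite !ffunE !big1 ?subrr // => e _;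
    rewrite ffunE.
  by rewrite -[in LHS](subrr 0) chainRB int_alongB !subrr.
move=> [a a0 /= fa] [b b0 /= gb]; exists (a - b) => /=.
  by rewrite /H1Z /= codiffB a0 b0 subrr.
by rewrite chainRB int_alongB fa gb.
Qed.

HB.instance Definition _ := GRing.isZmodClosed.Build Omega_sharp
  H1_pred H1_zmod_closed.

Definition Jacobian := Quotient.quot H1_pred.
HB.instance Definition _ := ZmodQuotient.on Jacobian.

End Jacobian.

(* Degenerate segments {0} for the vertices, segments [0, len e] for the edges. *)
Definition cell (R : realType) (G : wmgraph R) (i : vertex G + edge G) : set R :=
  match i with
  | inl _ => [set 0]
  | inr e => [set t | 0 <= t <= len e]
  end.

Definition cells (R : realType) (G : wmgraph R) :=
  {i : vertex G + edge G & set_type (cell i)}.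
HB.instance Definition _ R G := Topological.on (@cells R G).

(* Two points are glued together when they have the same image by this map. *)
Definition glue_point (R : realType) (G : wmgraph R) (p : cells G) :
    vertex G + edge G * R :=
  match p with
  | existT (inl v) _ => inl v
  | existT (inr e) t =>
      if val t == 0 then inl (tail e)
      else if val t == len e then inl (head e)
      else inr (e, val t)
  end.

Definition glued (R : realType) (G : wmgraph R) : rel (cells G) :=
  [rel p q | glue_point p == glue_point q].

Fact glued_is_equiv (R : realType) (G : wmgraph R) :
  equiv_class_of (@glued R G).
Proof.
split=> [p|p q|q p r]; rewrite /glued /=; [exact: eqxx|exact: eq_sym|].
by move=> /eqP->.
Qed.

Canonical glued_equiv (R : realType) (G : wmgraph R) :=
  EquivRelPack (@glued_is_equiv R G).
Canonical glued_encModRel (R : realType) (G : wmgraph R) :=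
  defaultEncModRel (@glued R G).

Definition realization (R : realType) (G : wmgraph R) :=
  quotient_topology {eq_quot @glued R G}%qT.
HB.instance Definition _ R G := Quotient.on (@realization R G).
HB.instance Definition _ R G := Topological.on (@realization R G).

Definition two_connected (R : realType) (G : wmgraph R) : Prop :=
  weighted_graph G /\ forall p : realization G, connected (~` [set p]).

Record subgraph (R : realType) (G : wmgraph R) := Subgraph {
  sub_vertex : {set vertex G};
  sub_edge : {set edge G};
  sub_tail : forall e, e \in sub_edge -> tail e \in sub_vertex;
  sub_head : forall e, e \in sub_edge -> head e \in sub_vertex }.

Definition wmgraph_of_subgraph (R : realType) (G : wmgraph R) (H : subgraph G) :
    wmgraph R :=
  @WMGraph R
    {x : vertex G | x \in sub_vertex H}
    {e : edge G | e \in sub_edge H}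
    (fun e => exist _ (tail (val e)) (sub_tail (valP e)))
    (fun e => exist _ (head (val e)) (sub_head (valP e)))
    (fun e => len (val e))
    (fun e => len_gt0 (val e)).

Coercion wmgraph_of_subgraph : subgraph >-> wmgraph.

Definition subgraph_le (R : realType) (G : wmgraph R) (H K : subgraph G) : bool :=
  (sub_vertex H \subset sub_vertex K) && (sub_edge H \subset sub_edge K).

Definition maximal_two_connected (R : realType) (G : wmgraph R)
    (H : subgraph G) : Prop :=
  two_connected H /\
  forall K : subgraph G, two_connected K -> subgraph_le H K -> subgraph_le K H.

Definition commensurable_edges (R : realType) (G : wmgraph R) : Prop :=
  forall e f : edge G, exists q : rat, len e / len f = ratr q.

(* Main.v *)
From HB Require Import structures.
From mathcomp Require Import all_boot all_order all_algebra ring_quotient.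
From mathcomp Require Import all_classical reals topology normedtype.
From mathcomp Require Import ring lra zify.
Require Import Defs.

(** Why the theorem is true.

    Write [<a, b>] for the sum over the edges of [len e * a e * b e], and call a
    chain with zero boundary a cycle. Harmonic forms and real cycles are the same
    functions on edges, so the integral along [a] vanishes exactly when [a] is
    [<,>]-orthogonal to all cycles. As J(G) is generated by the classes of the
    edges, it is finite if and only if every edge [e] has a nonzero multiple whose
    integral is that of an integral cycle ([finite_JacobianP]). Equivalently, the
    orthogonal projection [q e] of every edge [e] onto the cycle space has
    rational coefficients.

    The graph theory is carried by the edge sets [S] such that cutting a cycle down
    to [S] gives a cycle again ([splits]). They are stable under complement and
    intersection, and [block e] is the least one that contains [e].

    If J(G) is finite, the symmetry [len f * q e f = len e * q f e] of the
    projection says that [len e / len f] is rational as soon as [q e f] is nonzero.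
    Hence the edges commensurable with a given edge form a splitting set
    ([splits_commensurable]). A splitting set contains all edges or no edge of a
    2-connected subgraph [H] ([splits_no_cut_vertex]). Indeed coboundaries, being the
    orthogonal complement of the cycles for the unweighted product, are cut by a
    splitting set into coboundaries. Cutting the coboundary of the indicator of a
    vertex [v] of [H] yields a potential that is locally constant off [v] and jumps
    by different amounts along the edges at [v] inside and outside [S]. This cannot
    happen if [H] minus [v] is connected.

    Conversely, let [e] be an edge on which some cycle does not vanish (otherwise
    its integral is zero). A cut vertex or a bridge of the subgraph formed by
    [block e] would give a smaller splitting set containing [e], so this subgraph is
    2-connected ([block_two_connected]) and lies in a maximal one. So its edges are
    commensurable, and the projection of [e] is found by solving a linear system with
    rational coefficients: it is the orthogonal decomposition of chains for weights
    that are rational on the block ([hodge_decomposition],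
    [commensurable_torsion]).

    What links the realization to these combinatorial conditions is that an edge set
    compatible at all vertices except [v] gives an open set of the realization
    ([open_star]), and conversely that a clopen part of the realization minus a point
    is constant along every segment that avoids this point
    ([connected_compl_point]). *)

Set Implicit Arguments.
Unset Strict Implicit.
Unset Printing Implicit Defensive.

Import Order.TTheory GRing.Theory Num.Theory.
Import numFieldNormedType.Exports.

Local Open Scope classical_set_scope.
Local Open Scope ring_scope.

(** * Boundary, coboundary and the decomposition of chains *)

Definition coboundary (R : realType) (G : wmgraph R) (A : zmodType)
    (phi : {ffun vertex G -> A}) : C1 G A :=
  [ffun e => phi (head e) - phi (tail e)].

Lemma codiff_adj (R : realType) (G : wmgraph R) (F : comPzRingType)
    (phi : {ffun vertex G -> F}) (a : C1 G F) :
  \sum_x phi x * codiff a x = \sum_e coboundary phi e * a e.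
Proof.
transitivity (\sum_x (\sum_(e | head e == x) phi (head e) * a e
                     - \sum_(e | tail e == x) phi (tail e) * a e)).
  apply: eq_bigr => x _; rewrite ffunE mulrBr !mulr_sumr.
  by congr (_ - _); apply: eq_bigr => e /eqP ->.
have part (end_ : edge G -> vertex G) (f : edge G -> F) :
    \sum_x \sum_(e | end_ e == x) f e = \sum_e f e.
  by symmetry; exact: partition_big.
rewrite sumrB !part -sumrB.
by apply: eq_bigr => e _; rewrite ffunE mulrBl.
Qed.

Lemma sum_sqr_eq0 (F : realFieldType) (I : finType) (r a : I -> F) :
  (forall i, 0 < r i) -> \sum_i r i * (a i * a i) = 0 -> forall i, a i = 0.
Proof.
move=> r0 s0 i; have := psumr_eq0P _ s0 => /(_ _ i isT) H.
have: r i * (a i * a i) = 0.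
  apply: H => j _; apply: mulr_ge0; first exact: ltW.
  by rewrite -expr2 sqr_ge0.
by move/eqP; rewrite !mulf_eq0 gt_eqF //= orbb => /eqP.
Qed.

Section Hodge.
Variables (R : realType) (G : wmgraph R) (F : realFieldType).
Variable r : edge G -> F.
Hypothesis r_gt0 : forall e, 0 < r e.

Notation chain := {ffun edge G -> F^o}.
Notation potential := {ffun vertex G -> F^o}.

Let del (a : chain) : potential := codiff a.
Let laplacian (phi : potential) : potential :=
  codiff ([ffun e => (r e)^-1 * coboundary phi e] : chain).

Fact del_is_linear : linear del.
Proof.
move=> k a b; apply/ffunP => x; rewrite !ffunE scalerBr !scaler_sumr.
rewrite addrACA -opprD -!big_split /=.
by congr (_ - _); apply: eq_bigr => e _; rewrite !ffunE.
Qed.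

HB.instance Definition _ := GRing.isLinear.Build F chain potential _ del del_is_linear.

Fact laplacian_is_linear : linear laplacian.
Proof.
move=> k a b; rewrite /laplacian -del_is_linear; congr (codiff _).
apply/ffunP => e; rewrite !ffunE.
rewrite -![_ *: _]/(_ * _); ring.
Qed.

HB.instance Definition _ :=
  GRing.isLinear.Build F potential potential _ laplacian laplacian_is_linear.

(** The weighted Laplacian is injective on boundaries: if it kills the boundary [p]
    of [b], then [p] has zero energy, hence zero coboundary, and [p] is orthogonal
    to itself because it pairs with [p] as [b] does with its coboundary. Being an
    endomorphism of the space of boundaries it is onto, which solves the Poisson
    equation for the boundary of [a]. This works over any ordered field, and the
    rational numbers are needed as well as the real ones. *)
Lemma hodge_decomposition (a : C1 G F) :
  exists (q : C1 G F) (phi : {ffun vertex G -> F}),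
    codiff q = 0 /\ forall e, a e = q e + (r e)^-1 * coboundary phi e.
Proof.
pose D := linfun del; pose L := linfun laplacian.
have cap0 : (limg D :&: lker L = 0)%VS.
  apply/eqP; rewrite -subv0; apply/subvP => phi; rewrite memv_cap memv_ker.
  case/andP => /memv_imgP[b _ ->]; rewrite !lfunE /= memv0.
  set p := del b => /eqP Lp.
  have dp : forall e, coboundary p e = 0.
    apply: (@sum_sqr_eq0 _ _ (fun e => (r e)^-1)).
      by move=> e; rewrite invr_gt0.
    have := codiff_adj p ([ffun e => (r e)^-1 * coboundary p e] : C1 G F).
    rewrite -[codiff _]/(laplacian p) Lp big1 => [dp0|x _]; last first.
      rewrite [X in _ * X]ffunE; exact: mulr0.
    apply: etrans (esym dp0); apply: eq_bigr => e _.
    by rewrite !ffunE mulrCA.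
  apply/eqP/ffunP => x; rewrite [RHS]ffunE.
  apply: (@sum_sqr_eq0 F _ (fun=> 1) p) => //.
  have := codiff_adj p b; rewrite [RHS]big1 => [p0|e _]; last first.
    by rewrite dp; exact: mul0r.
  by apply: etrans p0; apply: eq_bigr => y _; rewrite mul1r.
(* An injective endomorphism of a finite dimensional space is surjective. *)
have imL : (L @: limg D = limg D)%VS.
  apply/eqP; rewrite eqEdim; apply/andP; split; last by rewrite (limg_dim_eq cap0).
  apply/subvP => _ /memv_imgP[p _ ->]; rewrite lfunE /=.
  by apply/memv_imgP; exists [ffun e => (r e)^-1 * coboundary p e]; rewrite ?memvf ?lfunE.
have : D a \in (L @: limg D)%VS by rewrite imL memv_img // memvf.
case/memv_imgP => phi _; rewrite !lfunE /= => Dphi.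
exists (a - [ffun e => (r e)^-1 * coboundary phi e]), phi; split.
  by rewrite codiffB -[codiff a]/(del a) Dphi subrr.
by move=> e; rewrite !ffunE subrK.
Qed.

End Hodge.

(** * Finiteness of the Jacobian as torsion of the edges *)

Section EdgeClasses.
Variables (R : realType) (G : wmgraph R).

Lemma cycle_mem_Omega (w : C1 G R) : (w \in Omega G) = (codiff w == 0).
Proof. by rewrite memv_ker lfunE. Qed.

Lemma eq_int_alongP (a b : C1 G R) :
  int_along a = int_along b <->
  forall w : C1 G R, codiff w = 0 -> \sum_e a e * w e * len e = \sum_e b e * w e * len e.
Proof.
split=> [ab w w0|ab].
  have wO : w \in Omega G by rewrite cycle_mem_Omega w0.
  by have /lfunP/(_ (Subvs wO)) := ab; rewrite !int_alongE.
apply/lfunP => w; rewrite !int_alongE; apply: ab.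
by apply/eqP; rewrite -cycle_mem_Omega subvsP.
Qed.

Fact int_along_sharp (a : C1 G int) :
  int_along (chainR a) \in @Omega_sharp_pred R G.
Proof. by rewrite inE; exists a. Qed.


Definition sharp (a : C1 G int) : Omega_sharp G :=
  exist (fun f => f \in @Omega_sharp_pred R G) _ (int_along_sharp a).

Fact sharp_is_zmod_morphism : zmod_morphism sharp.
Proof. by move=> a b; apply: val_inj; rewrite raddfB /= chainRB int_alongB. Qed.

HB.instance Definition _ :=
  GRing.isZmodMorphism.Build (C1 G int) (Omega_sharp G) sharp sharp_is_zmod_morphism.

Definition jac (a : C1 G int) : Jacobian G := \pi_(Jacobian G)%qT (sharp a).

Fact jac_is_zmod_morphism : zmod_morphism jac.
Proof. by move=> a b; rewrite /jac !raddfB. Qed.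

HB.instance Definition _ :=
  GRing.isZmodMorphism.Build (C1 G int) (Jacobian G) jac jac_is_zmod_morphism.

Lemma jac_surj (x : Jacobian G) : exists a, jac a = x.
Proof.
rewrite -[x]reprK; case: (repr x) => f fS.
have : f \in @Omega_sharp_pred R G by [].
rewrite inE => -[a _ /= fE]; exists a.
by congr (\pi_(Jacobian G)%qT _); apply: val_inj.
Qed.

Lemma jac_eq0P (a : C1 G int) :
  jac a = 0 <-> exists b, codiff b = 0 /\ int_along (chainR a) = int_along (chainR b).
Proof.
have -> : jac a = 0 <-> sharp a \in @H1_pred R G.
  rewrite -[sharp a]subr0 Quotient.idealrBE /jac.
  by rewrite -(raddf0 (\pi_(Jacobian G)%qT)); split=> /eqP.
rewrite inE /=; split=> [[b b0 ab]|[b [b0 ab]]]; by exists b.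
Qed.

Definition edge_chain (e : edge G) : C1 G int := [ffun f => (f == e)%:Z].

Lemma chain_sumE (a : C1 G int) : a = \sum_e edge_chain e *~ a e.
Proof.
apply/ffunP => f; rewrite sum_ffunE (bigD1 f) //= big1 => [|e ef].
  by rewrite ffunMzE ffunE eqxx addr0 intz.
by rewrite ffunMzE ffunE eq_sym (negbTE ef) mul0rz.
Qed.

(** The Jacobian is a finitely generated abelian group, with the edges as
    generators, so it is finite as soon as the generators are torsion. The relation
    [N e = b] in J(G) is spelled out by testing both sides on harmonic forms. *)
Lemma finite_JacobianP :
  finite_set [set: Jacobian G] <->
  forall e : edge G, exists N (b : C1 G int), [/\ (0 < N)%N, codiff b = 0 &
    forall w : C1 G R, codiff w = 0 ->
      N%:R * w e * len e = \sum_f (b f)%:~R * w f * len f].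
Proof.
have torsion e N : jac (edge_chain e) *+ N = 0 <-> exists b : C1 G int, codiff b = 0 /\
    forall w : C1 G R, codiff w = 0 ->
      N%:R * w e * len e = \sum_f (b f)%:~R * w f * len f.
  have wE (w : C1 G R) : N%:R * w e * len e =
      \sum_f chainR (edge_chain e *+ N) f * w f * len f.
    rewrite (bigD1 e) //= big1 ?addr0 => [|f fe]; rewrite !ffunE ffunMnE ffunE.
      by rewrite eqxx rmorphMn.
    by rewrite (negbTE fe) mul0rn mul0r mul0r.
  have chE (b : C1 G int) (w : C1 G R) :
      \sum_f chainR b f * w f * len f = \sum_f (b f)%:~R * w f * len f.
    by apply: eq_bigr => f _; rewrite ffunE.
  rewrite -raddfMn jac_eq0P.
  split=> -[b [b0 bE]]; exists b; split=> //.
    by move=> w w0; rewrite wE -chE; move/eq_int_alongP : bE; exact.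
  by apply/eq_int_alongP => w w0; rewrite -wE chE bE.
split=> [fin e|tors].
  have : ~ injective (fun n => jac (edge_chain e) *+ n).
    move=> inj; apply: infinite_nat.
    have := @finite_preimage _ _ setT (fun n => jac (edge_chain e) *+ n).
    by rewrite preimage_setT; apply => // m n _ _; exact: inj.
    (* Two multiples of the class of [e] coincide, so their difference is a relation. *)
move/existsNP => [m /existsNP [n /not_implyP[mn neq]]].
  wlog lt_mn : m n mn neq / (m < n)%N.
    move=> wl; have [lt_mn|lt_nm|//] := ltngtP m n; first exact: (wl m n).
    by apply: (wl n m) => //; exact/nesym.
  have /torsion[b [b0 bE]] : jac (edge_chain e) *+ (n - m) = 0.
    by rewrite mulrnBr ?(ltnW lt_mn) // mn subrr.
  by exists (n - m)%N, b; rewrite subn_gt0.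
have /choice[N NP] : forall e, exists N, (0 < N)%N /\ jac (edge_chain e) *+ N = 0.
  move=> e; have [N [b [N0 b0 bE]]] := tors e.
  by exists N; split=> //; apply/torsion; exists b.
(* A common exponent, modulo which the coefficients of a chain can be reduced. *)
pose M := (\prod_e N e)%N.
have M0 : (0 < M)%N by apply: prodn_gt0 => e; case: (NP e).
have tM e : jac (edge_chain e) *+ M = 0.
  by rewrite /M (bigD1 e) //= mulrnA (NP e).2 mul0rn.
pose g (k : {ffun edge G -> 'I_M}) : Jacobian G := \sum_e jac (edge_chain e) *+ k e.
apply: (@sub_finite_set _ _ (range g)); last by apply: finite_image; exact: finite_finset.
move=> x _; have [a <-] := jac_surj x.
have mM e : (`|(a e %% M)%Z|%N < M)%N.
  rewrite -ltz_nat gez0_abs ?modz_ge0 ?ltz_pmod //.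
  by rewrite gt_eqF.
exists [ffun e => Ordinal (mM e)] => //.
rewrite [in RHS](chain_sumE a) raddf_sum; apply: eq_bigr => e _.
rewrite raddfMz ffunE /= pmulrn gez0_abs ?modz_ge0 ?gt_eqF //.
rewrite [in RHS](divz_eq (a e) M) [RHS]mulrzDr [(_ * M%:Z)%R]mulrC mulrzA.
by rewrite -pmulrn tM mul0rz add0r.
Qed.
End EdgeClasses.

(** * Edge sets that split the cycle space *)

(** Cycles are the orthogonal complement of the coboundaries. *)
Lemma cycleP (R : realType) (G : wmgraph R) (F : comNzRingType) (a : C1 G F) :
  codiff a = 0 <-> forall phi : {ffun vertex G -> F}, \sum_e coboundary phi e * a e = 0.
Proof.
split=> [a0 phi|a0].
  by rewrite -codiff_adj a0 big1 // => x _; rewrite ffunE mulr0.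
apply/ffunP => x; have := a0 [ffun y => (y == x)%:R].
rewrite -codiff_adj (bigD1 x) //= big1 => [|y yx]; last first.
  by rewrite ffunE (negbTE yx) mul0r.
by rewrite addr0 [X in X * _]ffunE eqxx mul1r => ->; rewrite ffunE.
Qed.

Definition restrict (R : realType) (G : wmgraph R) (S : {set edge G})
    (h : C1 G R) : C1 G R :=
  [ffun e => if e \in S then h e else 0].

Definition splits (R : realType) (G : wmgraph R) (S : {set edge G}) :=
  forall h : C1 G R, codiff h = 0 -> codiff (restrict S h) = 0.

Section Splits.
Variables (R : realType) (G : wmgraph R).

(** The weighted product is nondegenerate on cycles. *)
Lemma eq_cycle_of_pairing (r : edge G -> R) (h k : C1 G R) :
  (forall e, 0 < r e) -> codiff h = 0 -> codiff k = 0 ->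
  (forall w : C1 G R, codiff w = 0 ->
     \sum_e r e * (h e * w e) = \sum_e r e * (k e * w e)) ->
  h = k.
Proof.
move=> r0 h0 k0 hk; apply/ffunP => e; apply/eqP; rewrite -subr_eq0; apply/eqP.
have hk0 : codiff (h - k) = 0 by rewrite codiffB h0 k0 subrr.
suff /(_ e) : forall e, (h - k : C1 G R) e = 0 by rewrite !ffunE.
apply: (@sum_sqr_eq0 _ _ r) => //.
rewrite -[RHS](subrr (\sum_e r e * (k e * (h - k) e))) -[X in _ = X - _]hk //.
by rewrite -sumrB; apply: eq_bigr => f _; rewrite !ffunE; ring.
Qed.

(** [q e] is the orthogonal projection of the edge [e] onto the cycles. Projections
    are self-adjoint, so that the matrix [q e f * len f] is symmetric, and a nonzero
    entry makes [len e / len f] a quotient of rationals. Therefore [q] is block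
    diagonal for the commensurability classes. As every cycle [h] is the sum of the
    [h f * q f], its part on a class is the same sum restricted to that class. *)
Lemma splits_commensurable (q : edge G -> edge G -> rat) (e0 : edge G) :
  (forall e, codiff ([ffun f => ratr (q e f)] : C1 G R) = 0) ->
  (forall e (w : C1 G R), codiff w = 0 ->
     w e * len e = \sum_f ratr (q e f) * w f * len f) ->
  @splits R G [set f | `[< exists r : rat, len e0 / len f = ratr r >]]%SET.
Proof.
move=> q0 qE; set S := finset _.
have qsym e f : ratr (q e f) * len f = ratr (q f e) * len e :> R.
  have /(_ f [ffun g => ratr (q e g)] (q0 e)) := qE.
  have /(_ e [ffun g => ratr (q f g)] (q0 f)) := qE.
  rewrite !ffunE => -> ->.
  by apply: eq_bigr => g _; rewrite !ffunE; ring.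
have qS e f : e \in S -> f \notin S -> q e f = 0 /\ q f e = 0.
  rewrite !inE => -[r rE] /asboolPn fS.
  have [qfe0|qfe] := eqVneq (q f e) 0.
    have := qsym e f; rewrite qfe0 rmorph0 mul0r => /eqP.
    by rewrite mulf_eq0 (gt_eqF (len_gt0 f)) orbF fmorph_eq0 => /eqP ->.
  case: fS; exists (r * (q e f / q f e)).
  rewrite rmorphM /= -rE fmorph_div /=.
  have lf : len f != 0 by rewrite gt_eqF ?len_gt0.
  have le : len e != 0 by rewrite gt_eqF ?len_gt0.
  have qfe' : ratr (q f e) != 0 :> R by rewrite fmorph_eq0.
  have -> : ratr (q e f) = ratr (q f e) * len e / len f :> R.
    by rewrite -qsym mulfK.
  by field; rewrite lf le qfe'.
move=> h h0.
pose proj (P : pred (edge G)) : C1 G R := [ffun g => \sum_(f | P f) h f * ratr (q f g)].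
have proj0 P : codiff (proj P) = 0.
  apply/cycleP => phi; under eq_bigr do rewrite [proj P _]ffunE mulr_sumr.
  rewrite exchange_big big1 //= => f _.
  under eq_bigr do rewrite mulrCA.
  rewrite -mulr_sumr; have /cycleP/(_ phi) E := q0 f.
  rewrite -[RHS](mulr0 (h f)) -[X in _ = _ * X]E; congr (_ * _).
  by apply: eq_bigr => g _; rewrite [X in _ = _ * X]ffunE.
(* A cycle is its own projection. *)
have hE : h = proj predT.
  apply: (@eq_cycle_of_pairing len) => //; first exact: len_gt0.
  move=> w w0; under [RHS]eq_bigr do rewrite ffunE mulr_suml mulr_sumr.
  rewrite exchange_big; apply: eq_bigr => f _ /=.
  transitivity (h f * (w f * len f)); first by ring.
  by rewrite qE // mulr_sumr; apply: eq_bigr => g _; ring.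
suff -> : restrict S h = proj (mem S) by [].
apply/ffunP => g; rewrite ffunE [RHS]ffunE.
case: ifPn => gS; last first.
  by rewrite big1 // => f fS; rewrite (qS f g _ gS).1 // rmorph0 mulr0.
rewrite {1}hE ffunE (bigID (mem S)) /= [X in _ + X]big1 ?addr0 // => f fS.
by rewrite (qS g f gS fS).2 rmorph0 mulr0.
Qed.

(** The dual form of splitting. Decompose the restricted coboundary as a cycle plus
    a coboundary, for unit weights. The cycle part is orthogonal to every cycle [w]:
    pairing the restricted coboundary with [w] amounts to pairing the coboundary
    with the restriction of [w], which is a cycle. *)
Lemma splits_coboundary (S : {set edge G}) (phi : {ffun vertex G -> R}) :
  splits S -> exists psi : {ffun vertex G -> R},
    forall e, coboundary psi e = if e \in S then coboundary phi e else 0.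
Proof.
move=> splS.
have [h [psi [h0 hE]]] := @hodge_decomposition R G R (fun=> 1) (fun=> ltr01)
  (restrict S (coboundary phi)).
have {}hE e : restrict S (coboundary phi) e = h e + coboundary psi e.
  by rewrite hE invr1 mul1r.
suff hz : h = 0.
  by exists psi => e; have := hE e; rewrite hz !ffunE add0r => <-.
apply: (@eq_cycle_of_pairing (fun=> 1)) => // [|w w0].
  by apply/cycleP => p; rewrite big1 // => e _; rewrite [X in _ * X]ffunE mulr0.
rewrite [RHS]big1 => [|e _]; last by rewrite ffunE mul0r mulr0.
have /cycleP/(_ psi) := w0; have /cycleP/(_ phi) := splS _ w0.
move=> A B; rewrite -[RHS](subrr 0) -[X in _ = X - _]A -[X in _ = _ - X]B -sumrB.
apply: eq_bigr => e _.
have -> : h e = restrict S (coboundary phi) e - coboundary psi e by rewrite hE addrK.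
rewrite ![restrict _ _ _]ffunE; case: ifP => _; ring.
Qed.

End Splits.

Definition incident (R : realType) (G : wmgraph R) (x : vertex G) (e : edge G) :=
  (tail e == x) || (head e == x).

(** Stated on edge sets rather than on components of the graph minus [v]: an edge set
    that is a union of classes for the relation of sharing a vertex other than [v]
    is empty or full. Loops at [v] are thus classes on their own. *)
Definition no_cut_vertex (R : realType) (G : wmgraph R) :=
  forall (v : vertex G) (S : {set edge G}),
    (forall x e f, x != v -> incident x e -> incident x f -> (e \in S) = (f \in S)) ->
    forall e f, (e \in S) = (f \in S).

Definition no_bridge (R : realType) (G : wmgraph R) :=
  forall (e : edge G) (X : {set vertex G}),
    (forall f, f != e -> (tail f \in X) = (head f \in X)) ->
    (tail e \in X) = (head e \in X).

(** Let [psi] be a potential whose coboundary is that of the indicator of [v] on [S]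
    and zero off [S]. It is constant along edges that avoid [v], equals [psi v - 1] at
    the other end of an edge of [S] at [v], and [psi v] at the other end of an
    edge at [v] outside [S]. If edges of both kinds met at [v], the edges with an end
    [x] other than [v] where [psi x = psi v - 1] would contradict [no_cut_vertex]. *)
Lemma splits_no_cut_vertex (R : realType) (G : wmgraph R) (H : subgraph G)
    (S : {set edge G}) :
  splits S -> no_cut_vertex H ->
  forall e f : edge H, (val e \in S) = (val f \in S).
Proof.
move=> splS nocut.
have at_vertex (v : vertex H) (e f : edge H) :
    incident v e -> incident v f -> val e \in S -> val f \in S.
  move=> ve vf eS; apply/negPn/negP => fS.
  have [psi psiE] := splits_coboundary [ffun y => (y == val v)%:R] splS.
  have psiH (g : edge H) : psi (val (head g)) - psi (val (tail g)) =
      if val g \in S then (head g == v)%:R - (tail g == v)%:R else 0.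
    by have := psiE (val g); rewrite !ffunE -!val_eqE.
  (* The edge [e] is added by hand because it may be a loop at [v]. *)
  pose T := [set g : edge H | (g == e) || [exists x, [&& x != v, incident x g &
     psi (val x) == psi (val v) - 1]]]%SET.
  have TE x g : x != v -> incident x g -> (g \in T) = (psi (val x) == psi (val v) - 1).
    move=> xv xg; rewrite inE; apply/idP/idP => [/orP[/eqP ge|]|xE]; last first.
    - by apply/orP; right; apply/existsP; exists x; rewrite xv xg.
    - move=> /existsP[y /and3P[yv yg /eqP <-]].
      have [->//|xy] := eqVneq x y.
      have := psiH g.
      case/orP: xg => /eqP xg; case/orP: yg => /eqP yg; subst.
      - by rewrite eqxx in xy.
      - by rewrite (negbTE xv) (negbTE yv) subrr if_same => /eqP; rewrite subr_eq0 eq_sym.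
      - by rewrite (negbTE xv) (negbTE yv) subrr if_same => /eqP; rewrite subr_eq0.
      - by rewrite eqxx in xy.
    subst g; have := psiH e; rewrite eS.
    case/orP: xg => /eqP xg; case/orP: ve => /eqP ve.
    - by rewrite -ve -xg eqxx in xv.
    - rewrite xg ve eqxx (negbTE xv) subr0 /= => E.
      by apply/eqP; lra.
    - rewrite xg ve eqxx (negbTE xv) sub0r /= => E.
      by apply/eqP; lra.
    - by rewrite -ve -xg eqxx in xv.
  have : f \in T.
    rewrite -(nocut v T _ e f) ?inE ?eqxx // => x g g' xv xg xg'.
    by rewrite (TE x g) ?(TE x g').
  rewrite inE => /orP[/eqP fe|/existsP[y /and3P[yv yf /eqP yE]]].
    by rewrite fe eS in fS.
  have := psiH f; rewrite (negbTE fS).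
  case/orP: yf => /eqP yf; case/orP: vf => /eqP vf.
  - by rewrite -yf -vf eqxx in yv.
  - by rewrite yf vf yE => E; exfalso; lra.
  - by rewrite yf vf yE => E; exfalso; lra.
  - by rewrite -yf -vf eqxx in yv.
(* Now [S] is compatible at every vertex, so any vertex may serve as [v]. *)
move=> e f.
have := nocut (tail e) [set g | val g \in S]%SET _ e f; rewrite !inE; apply.
by move=> x g g' _ xg xg'; rewrite !inE; apply/idP/idP; exact: (at_vertex x).
Qed.

(** * Blocks: minimal splitting sets *)

Lemma codiff_map (R : realType) (G : wmgraph R) (A B : zmodType)
    (f : A -> B) (a : C1 G A) (b : C1 G B) : zmod_morphism f ->
  (forall e, b e = f (a e)) -> forall x, codiff b x = f (codiff a x).
Proof.
move=> fB bE x.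
pose f' : {additive A -> B} := HB.pack f (GRing.isZmodMorphism.Build A B f fB).
have fsum (P : pred (edge G)) : f (\sum_(e | P e) a e) = \sum_(e | P e) b e.
  by rewrite -[f]/(f' : A -> B) raddf_sum; apply: eq_bigr => e _; rewrite bE.
by rewrite !ffunE fB !fsum.
Qed.

Section Blocks.
Variables (R : realType) (G : wmgraph R).
Implicit Types (S K : {set edge G}) (e f : edge G) (h w : C1 G R).

Lemma splitsC S : splits S -> splits (~: S).
Proof.
move=> splS h h0.
suff -> : restrict (~: S) h = h - restrict S h by rewrite codiffB h0 splS ?subrr.
apply/ffunP => e; rewrite !ffunE inE.
by case: (e \in S); rewrite ?subr0 ?subrr.
Qed.

Lemma splitsI S K : splits S -> splits K -> splits (S :&: K).
Proof.
move=> splS splK h h0.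
suff -> : restrict (S :&: K) h = restrict S (restrict K h) by exact/splS/splK.
by apply/ffunP => e; rewrite !ffunE inE; case: (e \in S).
Qed.

Lemma splitsT : @splits R G [set: edge G]%SET.
Proof.
move=> h h0; suff -> : restrict [set: edge G]%SET h = h by [].
by apply/ffunP => e; rewrite ffunE inE.
Qed.

Definition block e : {set edge G} :=
  (\bigcap_(S | `[< splits S >] && (e \in S)) S)%SET.

Lemma mem_block e : e \in block e.
Proof. by apply/bigcapP => S /andP[]. Qed.

Lemma splits_block e : splits (block e).
Proof.
rewrite /block; elim/big_ind: _ => [|S K|S /andP[/asboolP//]].
  exact: splitsT.
exact: splitsI.
Qed.

Lemma block_splits e f S : splits S -> f \in block e -> (e \in S) = (f \in S).
Proof.
move=> splS /bigcapP fe; apply/idP/idP => [eS|fS].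
  by apply: fe; rewrite eS andbT; apply/asboolP.
apply/negPn/negP => eS.
have : f \in ~: S by apply: fe; rewrite inE eS andbT; apply/asboolP/splitsC.
by rewrite inE fS.
Qed.

Fact edge_subgraph_tail K e :
  e \in K -> tail e \in [set x | [exists f in K, incident x f]]%SET.
Proof.
by move=> eK; rewrite inE; apply/existsP; exists e; rewrite eK /incident eqxx.
Qed.

Fact edge_subgraph_head K e :
  e \in K -> head e \in [set x | [exists f in K, incident x f]]%SET.
Proof.
by move=> eK; rewrite inE; apply/existsP; exists e; rewrite eK /incident eqxx orbT.
Qed.

Definition edge_subgraph K : subgraph G :=
  Subgraph (@edge_subgraph_tail K) (@edge_subgraph_head K).

Lemma edge_subgraph_incident K (x : vertex (edge_subgraph K)) :
  exists e : edge (edge_subgraph K), incident x e.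
Proof.
have := valP x; rewrite inE => /existsP[e /andP[eK xe]].
by exists (Sub e eK).
Qed.

(** Away from [v] the boundary of the part on [S] of a cycle on [K] is either that of
    the whole cycle or zero. It vanishes at [v] too, because the values of a boundary
    sum to zero. *)
Lemma splits_cut_vertex K S (v : vertex G) :
  splits K -> S \subset K ->
  (forall x e f, x != v -> e \in K -> f \in K ->
     incident x e -> incident x f -> (e \in S) = (f \in S)) ->
  splits S.
Proof.
move=> splK /fintype.subsetP SK cutv h h0.
have hK0 := splK _ h0.
have offv x : x != v -> codiff (restrict S h) x = 0.
  move=> xv.
  have [/existsP[e /andP[eS xe]]|/existsPn noS] :=
      boolP [exists e, (e \in S) && incident x e].
    transitivity (codiff (restrict K h) x); last by rewrite hK0 ffunE.
    have eq f : incident x f -> restrict S h f = restrict K h f.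
      move=> xf; rewrite !ffunE.
      case: (boolP (f \in K)) => [fK|fK].
        by rewrite -(cutv x e f xv (SK _ eS) fK xe xf) eS.
      by rewrite (contraNF (SK f) fK).
    rewrite [LHS]ffunE [RHS]ffunE.
    congr (_ - _); apply: eq_bigr => f xf; apply: eq.
      by rewrite /incident xf orbT.
    by rewrite /incident xf.
  have z f : incident x f -> restrict S h f = 0.
    by move=> xf; have := noS f; rewrite xf andbT ffunE => /negbTE ->.
  rewrite ffunE !big1 ?subrr // => f xf; apply: z.
    by rewrite /incident xf.
  by rewrite /incident xf orbT.
apply/ffunP => x; rewrite [RHS]ffunE.
have [->{x}|] := eqVneq x v; last exact: offv.
have := codiff_adj [ffun=> 1] (restrict S h).
rewrite (bigD1 v) //= big1 => [|x xv]; last by rewrite offv // mulr0.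
rewrite [X in X * _]ffunE mul1r addr0 => ->.
by rewrite big1 // => f _; rewrite [X in X * _]ffunE !ffunE subrr mul0r.
Qed.

(** A cut vertex would split the block into two smaller splitting sets. *)
Lemma block_no_cut_vertex e : no_cut_vertex (edge_subgraph (block e)).
Proof.
set K := block e => v S cutv.
pose S' : {set edge G} := (val @: S)%SET.
have S'E (f : edge (edge_subgraph K)) : (val f \in S') = (f \in S).
  by rewrite mem_imset //; exact: val_inj.
have splS' : splits S'.
  apply: (@splits_cut_vertex K _ (val v)); first exact: splits_block.
    by apply/fintype.subsetP => _ /imsetP[f _ ->]; exact: valP.
  move=> x f g xv fK gK xf xg.
  have xK : x \in sub_vertex (edge_subgraph K).
    by rewrite inE; apply/existsP; exists f; rewrite fK.
  have := cutv (Sub x xK) (Sub f fK) (Sub g gK).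
  by rewrite -!S'E /=; apply.
move=> f g; rewrite -!S'E -(block_splits splS' (valP f)).
exact: block_splits splS' (valP g).
Qed.

(** Cycles vanish on a bridge [f], since the net flow of a cycle out of [X] is zero.
    So the singleton [f] splits, and the block is reduced to [f], which is [e]
    itself, contrary to [h e <> 0]. *)
Lemma block_no_bridge e h :
  codiff h = 0 -> h e != 0 -> no_bridge (edge_subgraph (block e)).
Proof.
set K := block e => h0 he f X cutX; apply/eqP; rewrite -[_ == _]negbK; apply/negP => fX.
pose X' : {set vertex G} := (val @: X)%SET.
have X'E (x : vertex (edge_subgraph K)) : (val x \in X') = (x \in X).
  by rewrite mem_imset //; exact: val_inj.
have tX (g : edge (edge_subgraph K)) : (tail (val g) \in X') = (tail g \in X).
  exact: X'E (tail g).
have hX (g : edge (edge_subgraph K)) : (head (val g) \in X') = (head g \in X).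
  exact: X'E (head g).
have wf0 w : codiff w = 0 -> w (val f) = 0.
  move=> w0; have /cycleP/(_ [ffun x => (x \in X')%:R]) := splits_block e w0.
  rewrite (bigD1 (val f)) //= big1 => [|g gf].
    rewrite addr0 !ffunE (valP f) /= tX hX => /eqP; rewrite mulf_eq0.
    rewrite [X in X || _](_ : _ = false) /= => [/eqP//|].
    move: fX; case: (tail f \in X); case: (head f \in X) => //= _.
    - by rewrite mulr0n sub0r oppr_eq0 oner_eq0.
    - by rewrite mulr0n subr0 oner_eq0.
  rewrite !ffunE; case: ifP => gK; last by rewrite mulr0.
  pose g' : edge (edge_subgraph K) := Sub g gK.
  have : (tail g' \in X) = (head g' \in X) by apply: cutX; rewrite -val_eqE.
  by rewrite -tX -hX /= => ->; rewrite subrr mul0r.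
have splf : splits [set val f]%SET.
  move=> w w0; suff -> : restrict [set val f]%SET w = 0.
    by apply/cycleP => p; rewrite big1 // => g _; rewrite [X in _ * X]ffunE mulr0.
  by apply/ffunP => g; rewrite !ffunE inE; case: eqP => // ->; exact: wf0.
have := block_splits splf (valP f); rewrite !inE eqxx => /eqP ef.
by move: he; rewrite ef wf0 ?eqxx.
Qed.

(** Weigh the edges by [len f / len e] on the block, and by 1 elsewhere. These weights
    are rational, so the decomposition of the chain [e] over the rationals gives a
    rational cycle [q]. Its restriction to the block is a cycle with the same
    pairing as [e] with every real cycle, and [N] clears its denominators. *)
Lemma commensurable_torsion e :
  (forall f, f \in block e -> exists r : rat, len f / len e = ratr r) ->
  exists N (b : C1 G int), [/\ (0 < N)%N, codiff b = 0 &
    forall w, codiff w = 0 ->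
      N%:R * w e * len e = \sum_f (b f)%:~R * w f * len f].
Proof.
move=> comm; set K := block e in comm.
have /choice[r rP] : forall f, exists s : rat, 0 < s /\ (f \in K -> len f / len e = ratr s).
  move=> f; have [fK|fK] := boolP (f \in K); last by exists 1.
  have [s sE] := comm f fK; exists s; split=> //.
  by rewrite -(ltr0q R) -sE divr_gt0 ?len_gt0.
have [q [phi [q0 qE]]] := hodge_decomposition (fun f => (rP f).1)
  ([ffun f => (f == e)%:R] : C1 G rat).
pose N := (\prod_f `|denq (q f)|)%N.
have N0 : (0 < N)%N by apply: prodn_gt0 => f; rewrite absz_gt0 denq_neq0.
have /choice[c cE] : forall f, exists c : int, c%:~R = N%:R * q f.
  move=> f; exists ((\prod_(g | g != f) `|denq (q g)|)%N%:Z * numq (q f)).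
  have -> : N = (`|denq (q f)| * \prod_(g | g != f) `|denq (q g)|)%N.
    by rewrite /N (bigD1 f).
  have qfE : q f = (numq (q f))%:~R / (denq (q f))%:~R by rewrite divq_num_den.
  rewrite natrM intrM natr_absz normr_denq [X in _ = _ * X]qfE -pmulrn.
  by field; rewrite intr_eq0 denq_neq0.
pose b : C1 G int := [ffun f => if f \in K then c f else 0].
have bE (w : C1 G R) f : (b f)%:~R * w f * len f =
   N%:R * len e * (ratr (q f) * restrict K w f * ratr (r f)).
  rewrite !ffunE; case: ifP => fK; last by rewrite mulr0 !mul0r mulr0.
  rewrite -(rP f).2 // -(ratr_int R) cE rmorphM /= ratr_nat.
  by field; rewrite gt_eqF ?len_gt0.
exists N, b; split=> // [|w w0].
  apply/ffunP => x; rewrite [RHS]ffunE; apply/eqP; rewrite -(intr_eq0 R); apply/eqP.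
  pose Nq : C1 G R := [ffun f => ratr (N%:R * q f)].
  have Nq0 : codiff Nq = 0.
    apply/ffunP => y.
    rewrite (@codiff_map _ _ rat R (fun x => ratr (N%:R * x)) q) => [|u v|f].
    - by rewrite q0 !ffunE mulr0 rmorph0.
    - by rewrite mulrBr rmorphB.
    - by rewrite ffunE.
  rewrite -(@codiff_map _ _ int R intr b (restrict K Nq)) => [|u v|f].
  - by rewrite splits_block // ffunE.
  - by rewrite rmorphB.
  - by rewrite !ffunE; case: ifP => // fK; rewrite -cE ratr_int.
under eq_bigr do rewrite bE.
rewrite -mulr_sumr -mulrA [w e * _]mulrC mulrA; congr (_ * _).
have wK0 := splits_block e w0.
transitivity (\sum_f ratr ((f == e)%:R) * restrict K w f * ratr (r f)).
  rewrite (bigD1 e) //= eqxx big1 ?addr0 => [|f /negbTE ->].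
    rewrite ffunE mem_block rmorph1 mul1r -(rP e).2 ?mem_block //.
    by rewrite divff ?mulr1 // gt_eqF ?len_gt0.
  by rewrite rmorph0 !mul0r.
(* The two sides differ by the pairing of a coboundary with the cycle [w] on [K]. *)
apply/eqP; rewrite -subr_eq0 -sumrB; apply/eqP.
have /cycleP/(_ [ffun x => ratr (phi x)]) E := wK0.
rewrite -[RHS]E; apply: eq_bigr => f _.
have -> : (f == e)%:R = q f + (r f)^-1 * coboundary phi f.
  by rewrite -qE ffunE.
rewrite !ffunE rmorphD rmorphM fmorphV rmorphB /=.
field.
by rewrite fmorph_eq0 gt_eqF // (rP f).1.
Qed.
End Blocks.

(** * Topology of the realization *)

Section Realization.
Variables (R : realType) (G : wmgraph R).
Implicit Types (p q : realization G) (e f : edge G) (x v : vertex G) (t : R).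

(** A faithful coordinate system: [realization] identifies the points with the same
    image by [glue_point]. *)
Definition position q : vertex G + edge G * R := glue_point (repr q).

Lemma position_pi (c : cells G) :
  position (\pi_(realization G)%qT c) = glue_point c.
Proof.
apply/eqP.
have /eqmodP : (repr (\pi_(realization G)%qT c) = c %[mod {eq_quot @glued R G}])%qT.
  exact: reprK.
by [].
Qed.

Lemma position_inj : injective position.
Proof.
move=> p q pq; rewrite -[p]reprK -[q]reprK.
by apply/(@eqmodP _ (glued_equiv G)); apply/eqP.
Qed.

Definition vertex_cell x : set_type (cell (inl x : vertex G + edge G)) :=
  SigSub (mem_set (erefl (0 : R))).

Definition vertex_point x : realization G :=
  \pi_(realization G)%qT (existT _ (inl x) (vertex_cell x)).

Fact clamp_in e t : Num.max 0 (Num.min t (len e)) \in cell (inr e : vertex G + edge G).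
Proof.
apply/mem_set => /=; rewrite le_max lexx /= ge_max ge_min lexx orbT andbT.
exact/ltW/len_gt0.
Qed.

Definition edge_cell e t : set_type (cell (inr e : vertex G + edge G)) :=
  SigSub (clamp_in e t).

(** The parameter is clamped to the segment, so that the path is continuous on the
    whole line. *)
Definition edge_point e t : realization G :=
  \pi_(realization G)%qT (existT _ (inr e) (edge_cell e t)).

Lemma edge_point_continuous e : continuous (edge_point e).
Proof.
have cell_cont : continuous (edge_cell e).
  apply: continuous_comp_initial => t.
  change {for t, continuous (((fun=> 0) : R -> R) \max (id \min (fun=> len e)))}.
  apply: continuous_max; first exact: cst_continuous.
  by apply: continuous_min; [exact: cvg_id|exact: cst_continuous].
move=> t; apply: (@continuous_comp _ _ _
  (fun t => existT _ (inr e) (edge_cell e t) : cells G) \pi_(realization G)%qT).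
  apply: (@continuous_comp _ _ _ (edge_cell e)
    (existT (fun i : vertex G + edge G => set_type (cell i)) (inr e))).
    exact: cell_cont.
  exact: existT_continuous.
exact: pi_continuous.
Qed.

Lemma position_vertex x : position (vertex_point x) = inl x.
Proof. by rewrite position_pi. Qed.

Lemma position_edge e t : 0 <= t <= len e ->
  position (edge_point e t) = if t == 0 then inl (tail e) else
                              if t == len e then inl (head e) else inr (e, t).
Proof.
move=> /andP[t0 te]; rewrite position_pi /=.
by rewrite min_l // max_r.
Qed.

Lemma edge_point0 e : edge_point e 0 = vertex_point (tail e).
Proof.
apply: position_inj; rewrite position_vertex position_edge ?eqxx //.
by rewrite lexx ltW ?len_gt0.
Qed.

Lemma edge_point_len e : edge_point e (len e) = vertex_point (head e).
Proof.
apply: position_inj; rewrite position_vertex position_edge ?eqxx ?gt_eqF ?len_gt0 //.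
by rewrite lexx ltW ?len_gt0.
Qed.

Lemma position_inside e t : 0 < t < len e -> position (edge_point e t) = inr (e, t).
Proof.
move=> /andP[t0 te]; rewrite position_edge ?(ltW t0) ?(ltW te) //.
by rewrite (gt_eqF t0) (lt_eqF te).
Qed.

Variant realization_spec : realization G -> Type :=
| RealizationVertex x : realization_spec (vertex_point x)
| RealizationEdge e t of 0 < t < len e : realization_spec (edge_point e t).

Lemma realizationP q : realization_spec q.
Proof.
have [[x ->]|[[e t] [tin ->]]] :
    {x | q = vertex_point x} + {et | 0 < et.2 < len et.1 /\ q = edge_point et.1 et.2}.
  have : position q = position q by [].
  rewrite {2}/position; case: (repr q) => -[x|e] t /=.
    by move=> qx; left; exists x; apply: position_inj; rewrite qx position_vertex.
  have /andP[t0 te] : 0 <= val t <= len e by have := set_mem (valP t).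
  case: ifPn => [_|tn0].
    by move=> qx; left; exists (tail e); apply: position_inj; rewrite qx position_vertex.
  case: ifPn => [_|tnl].
    by move=> qx; left; exists (head e); apply: position_inj; rewrite qx position_vertex.
  have tin : 0 < val t < len e by rewrite !lt_neqAle t0 te eq_sym tn0 tnl.
  move=> qe; right; exists (e, val t); split=> //.
  by apply: position_inj; rewrite qe position_inside.
- exact: RealizationVertex.
- exact: RealizationEdge.
Qed.

(** The hypothesis makes this set a union of connected components of the realization
    minus the point [v]: it meets the segment of an edge of [S] in the segment
    deprived of its ends at [v], and misses the segments of the other edges. *)
Lemma open_star (v : vertex G) (P : pred (vertex G)) (S : {set edge G}) :
  (forall x e, x != v -> incident x e -> P x = (e \in S)) ->
  open [set q : realization G | match position q with
                               | inl x => (x != v) && P x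
                               | inr et => et.1 \in S
                               end].
Proof.
move=> PS; set U := [set q | _].
change (open (\pi_(realization G)%qT @^-1` U)).
apply/sigT_openP => -[x|e].
  have [xP|xP] := boolP ((x != v) && P x).
    rewrite (_ : _ @^-1` _ = setT); first exact: openT.
    by apply/seteqP; split=> // t _; rewrite /U /= position_pi.
  rewrite (_ : _ @^-1` _ = set0); first exact: open0.
  by apply/seteqP; split=> // t; rewrite /U /= position_pi /= (negbTE xP).
have [eS|eS] := boolP (e \in S); last first.
  rewrite (_ : _ @^-1` _ = set0); first exact: open0.
  apply/seteqP; split=> // t; rewrite /U /= position_pi /=.
  case: ifP => _.
    move=> /andP[xv]; rewrite (PS _ e) ?(negbTE eS) // /incident eqxx //.
  case: ifP => _; last by rewrite /= (negbTE eS).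
  by move=> /andP[xv]; rewrite (PS _ e) ?(negbTE eS) // /incident eqxx orbT.
(* The trace on the segment of [e], as an open set of the line. *)
pose O : set R := [set t | t = 0 -> tail e != v] `&` [set t | t = len e -> head e != v].
have oO : open O.
  apply: openI.
    have [tv|tv] := eqVneq (tail e) v.
      rewrite (_ : [set t | _] = ~` [set 0]); last first.
        by apply/seteqP; split=> t /= H t0; have := H t0.
      by rewrite openC; apply: closed_eq.
    rewrite (_ : [set t | _] = setT); first exact: openT.
    by apply/seteqP; split.
  have [tv|tv] := eqVneq (head e) v.
    rewrite (_ : [set t | _] = ~` [set len e]); last first.
      by apply/seteqP; split=> t /= H t0; have := H t0.
    by rewrite openC; apply: closed_eq.
  rewrite (_ : [set t | _] = setT); first exact: openT.
  by apply/seteqP; split.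
exists O => //; apply/seteqP; split=> t; rewrite /U /O /= position_pi /=.
  move=> [t0 tl].
  case: ifP => [/eqP/t0 tv|_].
    by rewrite tv (PS _ e) // /incident eqxx.
  case: ifP => [/eqP/tl tv|_ //].
  by rewrite tv (PS _ e) // /incident eqxx orbT.
case: ifP => [/eqP tE|/eqP tN].
  move=> /andP[tv _]; split=> // tl; exfalso.
  by have := len_gt0 e; rewrite -tl /set_val /= tE ltxx.
case: ifP => [/eqP tE /andP[tv _]|/eqP tM _]; by split.
Qed.

(** An edge set compatible off [v] and its complement give two disjoint open sets that
    cover the realization minus [v]. *)
Lemma connected_no_cut_vertex :
  (forall p, connected (~` [set p])) -> no_cut_vertex G.
Proof.
move=> conn v S cutv.
suff sub e f : e \in S -> f \in S by move=> e f; apply/idP/idP; exact: sub.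
move=> eS.
pose P x := [exists e, (e \in S) && incident x e].
have PS x g : x != v -> incident x g -> P x = (g \in S).
  move=> xv xg; apply/existsP/idP => [[h /andP[hS xh]]|gS]; last by exists g; rewrite gS.
  by rewrite (cutv x g h).
have PS' x g : x != v -> incident x g -> ~~ P x = (g \in ~: S)%SET.
  by move=> xv xg; rewrite inE (PS x g).
have oU := open_star PS; have oU' := open_star (P := fun x => ~~ P x) PS'.
set U := [set q | _] in oU; set U' := [set q | _] in oU'.
have mid (g : edge G) : 0 < len g / 2 < len g.
  by have := len_gt0 g; move=> ?; apply/andP; split; lra.
have UE : U = ~` [set vertex_point v].
  apply: conn.
  - by exists (edge_point e (len e / 2)); rewrite /U /= position_inside.
  - exists U => //; apply/seteqP; split=> [q Uq|q [] //]; split=> // qv.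
    by move: Uq; rewrite /U /= qv position_vertex eqxx.
  - exists (~` U'); first by rewrite closedC.
    apply/seteqP; split=> [q Uq|q].
      split=> [qv|]; first by move: Uq; rewrite /U /= qv position_vertex eqxx.
      move: Uq; rewrite /U /U' /=; case: (position q) => [x|[g t]] /=.
        by move=> /andP[_ ->]; rewrite andbF.
      by rewrite inE => ->.
    rewrite /U /U' /= => -[].
    case: (realizationP q) => [x|g t tg].
      rewrite position_vertex => xv; have -> : x != v by apply/eqP => xv'; case: xv; rewrite xv'.
      by move=> /= /negP; rewrite negbK.
    by rewrite position_inside //= inE => _ /negP; rewrite negbK.
have : U (edge_point f (len f / 2)).
  rewrite UE /= => fv; have := position_inside (mid f).
  by rewrite fv position_vertex.
by rewrite /U /= position_inside.
Qed.

Section Connected.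
Hypothesis no_isolated : forall x, exists e, incident x e.
Hypothesis no_cut : no_cut_vertex G.
Hypothesis no_brg : no_bridge G.

(** A relatively clopen set [B] is constant along segments that avoid [p]. If [p] is a
    vertex, the edges whose midpoint is in [B] form a set compatible off [p]. If [p]
    is inside an edge [e0], membership in [B] agrees at both ends of the other
    edges, hence at both ends of [e0] since it is not a bridge, and the edges with
    their ends in [B] form a set compatible everywhere. In both cases this set is
    empty or full, and membership of a point in [B] is read off on an edge near it. *)
Lemma connected_compl_point p : connected (~` [set p]).
Proof.
set A := ~` [set p] => B [b Bb] [O oO BO] [C cC BC].
have seg e s t : 0 <= s <= t -> (forall u, s <= u <= t -> edge_point e u <> p) ->
    (edge_point e s \in B) = (edge_point e t \in B).
  move=> /andP[s0 st] avoid.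
  pose D := edge_point e @` `[s, t].
  have DA : D `<=` A.
    by move=> _ [u /= us <-]; apply: avoid; move: us; rewrite in_itv.
  have cD : connected D.
    apply: connected_continuous_connected; first exact: segment_connected.
    by apply: continuous_subspaceT => u; exact: edge_point_continuous.
  have DB : D `&` B !=set0 -> D `<=` B.
    move=> DB0; suff <- : D `&` B = D by move=> q [].
    apply: cD => //.
    - exists O => //; rewrite BO setIA; congr (_ `&` _).
      by apply/seteqP; split=> [q []//|q Dq]; split=> //; exact: DA.
    - exists C => //; rewrite BC setIA; congr (_ `&` _).
      by apply/seteqP; split=> [q []//|q Dq]; split=> //; exact: DA.
  have Ds : D (edge_point e s) by exists s => //=; rewrite in_itv /= lexx st.
  have Dt : D (edge_point e t) by exists t => //=; rewrite in_itv /= lexx st.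
  apply/idP/idP => /set_mem Bq; apply/mem_set; apply: DB => //.
    by exists (edge_point e s).
  by exists (edge_point e t).
(* It suffices to encode membership in [B] by an edge set that is empty or full. *)
suff [S [Sall BS]] : exists S : {set edge G}, (forall e f, (e \in S) = (f \in S)) /\
    forall q, A q -> exists e, (q \in B) = (e \in S).
  have BA : B `<=` A by rewrite BO => q [].
  apply/seteqP; split=> // q Aq.
  have [e be] := BS b (BA _ Bb); have [f qf] := BS q Aq.
  by apply: set_mem; rewrite qf -(Sall e f) -be; exact: mem_set.
have ev e : 0 <= len e by rewrite ltW ?len_gt0.
case: (realizationP p) @A BO BC seg => [v|e0 t0 t0e] A BO BC seg.
  pose S := [set e | edge_point e (len e / 2) \in B]%SET.
  have inV e u : 0 < u < len e -> edge_point e u <> vertex_point v.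
    by move=> ue /(congr1 position); rewrite position_inside // position_vertex.
  have VE x e : x != v -> incident x e -> (vertex_point x \in B) = (e \in S).
    have le0 := len_gt0 e.
    move=> xv /orP[/eqP xe|/eqP xe]; rewrite inE -xe.
      rewrite -edge_point0; apply: seg => [|u /andP[u0 ue]].
        by apply/andP; split; lra.
      have [->|un0] := eqVneq u 0.
        rewrite edge_point0 xe => /(congr1 position); rewrite !position_vertex.
        by move=> [] /eqP; rewrite (negbTE xv).
      apply: inV; rewrite lt_neqAle eq_sym un0 u0 /=; lra.
    rewrite -edge_point_len; apply/esym; apply: seg => [|u /andP[u0 ue]].
      by apply/andP; split; lra.
    have [->|unl] := eqVneq u (len e).
      rewrite edge_point_len xe => /(congr1 position); rewrite !position_vertex.
      by move=> [] /eqP; rewrite (negbTE xv).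
    apply: inV; rewrite [u < _]lt_neqAle ue unl !andbT; lra.
  exists S; split.
    by apply: (no_cut (v := v)) => x e f xv xe xf; rewrite -(VE x e) // (VE x f).
  move=> q; case: (realizationP q) => [x|e t te] Aq.
    have [e xe] := no_isolated x; exists e; apply: VE => //.
    by apply/eqP => xv; apply: Aq; rewrite xv.
  have le0 := len_gt0 e; case/andP: te => t0 tl.
  exists e; rewrite inE.
  have [tm|/ltW tm] := leP t (len e / 2).
    by apply: seg => [|u /andP[u0 ue]]; [|apply: inV]; apply/andP; split; lra.
  by apply/esym; apply: seg => [|u /andP[u0 ue]]; [|apply: inV]; apply/andP; split; lra.
have [t00 t0l] := andP t0e.
pose X := [set x | vertex_point x \in B]%SET.
have notp e u : 0 <= u <= len e -> (e = e0 -> u != t0) -> edge_point e u <> edge_point e0 t0.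
  move=> ue eu /(congr1 position); rewrite (position_inside t0e) position_edge //.
  case: ifP => // _; case: ifP => // _ [ee ut].
  by move: (eu ee); rewrite ut eqxx.
have XE' e : e != e0 -> (tail e \in X) = (head e \in X).
  move=> ee0; rewrite !inE -edge_point0 -edge_point_len.
  apply: seg => [|u ue]; first by rewrite lexx ev.
  by apply: notp => // ee; rewrite ee eqxx in ee0.
have XE e : (tail e \in X) = (head e \in X).
  by have [->|] := eqVneq e e0; [exact: no_brg XE'|exact: XE'].
pose S := [set e | tail e \in X]%SET.
have XS x e : incident x e -> (x \in X) = (e \in S).
  by rewrite [e \in S]inE => /orP[] /eqP <-.
exists S; split=> [|q].
  by apply: (no_cut (v := tail e0)) => x e f _ xe xf; rewrite -(XS x e) // (XS x f).
case: (realizationP q) => [x|e t te] Aq.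
  by have [e xe] := no_isolated x; exists e; rewrite -(XS x e) // inE.
exists e; have [ts tl] := andP te.
have [lt_t|ge_t] : (e = e0 -> t < t0) \/ (e = e0 /\ t0 < t).
- have [ee|ee] := eqVneq e e0; last by left=> e'; rewrite e' eqxx in ee.
  have [||tt0] := ltgtP t t0; [by left|by right|].
  by case: Aq; rewrite ee tt0.
- rewrite !inE -edge_point0; apply/esym; apply: seg => [|u /andP[u0 ut]].
    by rewrite lexx ltW.
  apply: notp => [|/lt_t tt0]; first by rewrite u0 (le_trans ut) ?ltW.
  by rewrite lt_eqF // (le_lt_trans ut).
- case: ge_t => ee tt0.
  rewrite inE XE inE -edge_point_len; apply: seg => [|u /andP[tu ue]].
    by rewrite !ltW.
  apply: notp => [|_]; first by rewrite ue (le_trans _ tu) ?ltW.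
  by rewrite gt_eqF // (lt_le_trans tt0).
Qed.

End Connected.

(** The edges reachable from [x] form a set compatible at every vertex. *)
Lemma connected_graph :
  (0 < #|vertex G|)%N -> (forall x, exists e, incident x e) ->
  no_cut_vertex G -> weighted_graph G.
Proof.
move=> V0 no_isolated no_cut; split=> // x y.
pose S := [set e | connect (@adjacent R G) x (tail e)]%SET.
have adj e : adjacent (tail e) (head e).
  by apply/existsP; exists e; rewrite !eqxx.
have adj' e : adjacent (head e) (tail e).
  by apply/existsP; exists e; rewrite !eqxx orbT.
have SE z e : incident z e -> connect (@adjacent R G) x z = (e \in S).
  rewrite inE => /orP[] /eqP <- //; apply/idP/idP => xz.
    exact: connect_trans xz (connect1 (adj' e)).
  exact: connect_trans xz (connect1 (adj e)).
have [e xe] := no_isolated x; have [f yf] := no_isolated y.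
rewrite (SE y f) // -(no_cut x S _ e f) => [|z g h _ zg zh].
  by rewrite -(SE x e) ?connect0.
by rewrite -(SE z g) // (SE z h).
Qed.

End Realization.

(** * Maximal 2-connected subgraphs and the Jacobian *)

Lemma maximal_two_connected_above (R : realType) (G : wmgraph R) (K : subgraph G) :
  two_connected K -> exists M, maximal_two_connected M /\ subgraph_le K M.
Proof.
pose size_ (H : subgraph G) := (#|sub_vertex H| + #|sub_edge H|)%N.
have [n] := ubnP (#|vertex G| + #|edge G| - size_ K)%N.
elim: n K => // n IHn K le_n K2.
have [maxK|] := pselect (maximal_two_connected K).
  by exists K; split=> //; rewrite /subgraph_le !subxx.
move=> /not_andP[//|/existsNP[K' /not_implyP[K'2 /not_implyP[KK' nK'K]]]].
have [sV sE] := andP KK'.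
have lt_size : (size_ K < size_ K')%N.
  rewrite ltnNge; apply/negP => le_size; apply: nK'K.
  have [cV cE] := (subset_leq_card sV, subset_leq_card sE).
  apply/andP; split.
    suff /eqP -> : sub_vertex K == sub_vertex K' by [].
    by rewrite eqEcard sV; move: le_size; rewrite /size_; lia.
  suff /eqP -> : sub_edge K == sub_edge K' by [].
  by rewrite eqEcard sE; move: le_size; rewrite /size_; lia.
have le_K' : (size_ K' <= #|vertex G| + #|edge G|)%N by rewrite leq_add ?max_card.
have [|M [maxM /andP[MV ME]]] := IHn K' _ K'2; first by lia.
exists M; split=> //.
by rewrite /subgraph_le (fintype.subset_trans sV) // (fintype.subset_trans sE).
Qed.

Lemma block_two_connected (R : realType) (G : wmgraph R) (e : edge G) (h : C1 G R) :
  codiff h = 0 -> h e != 0 -> two_connected (edge_subgraph (block e)).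
Proof.
move=> h0 he; have no_cut := @block_no_cut_vertex R G e.
have no_isolated := @edge_subgraph_incident R G (block e).
split; last by move=> p; apply: connected_compl_point => //; exact: block_no_bridge h0 he.
apply: connected_graph => //.
by apply/card_gt0P; exists (tail (Sub e (mem_block e) : edge (edge_subgraph (block e)))).
Qed.

Theorem theorem2p15 (R : realType) (G : wmgraph R) (hG : weighted_graph G) :
  finite_set [set: Jacobian G] <->
  (forall H : subgraph G, maximal_two_connected H -> commensurable_edges H).
Proof.
rewrite finite_JacobianP; split=> [tors H [[_ conn] _] e f|comm e].
  have /choice[q qP] : forall g : edge G, exists q : {ffun edge G -> rat},
      codiff ([ffun f => ratr (q f)] : C1 G R) = 0 /\
      forall w : C1 G R, codiff w = 0 -> w g * len g = \sum_f ratr (q f) * w f * len f.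
    move=> g; have [N [b [N0 b0 bE]]] := tors g.
    have NR : N%:R != 0 :> R by rewrite pnatr_eq0 -lt0n.
    exists [ffun f => (b f)%:~R / N%:R]; split=> [|w w0].
      apply/ffunP => x; rewrite (@codiff_map _ _ int R (fun k => k%:~R / N%:R) b) => [|u v|f'].
      - by rewrite b0 !ffunE mul0r.
      - by rewrite rmorphB mulrBl.
      - by rewrite !ffunE fmorph_div /= ratr_int ratr_nat.
    apply: (mulfI NR); rewrite mulrA bE // mulr_sumr; apply: eq_bigr => f' _.
    rewrite ffunE fmorph_div /= ratr_int ratr_nat.
    by field.
  have spl := @splits_commensurable R G q (val e) (fun g => (qP g).1) (fun g => (qP g).2).
  have := splits_no_cut_vertex spl (connected_no_cut_vertex conn) e f.
  rewrite !inE => ef; apply/asboolP; rewrite -ef; apply/asboolP.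
  by exists 1; rewrite rmorph1 divff // gt_eqF ?len_gt0.
have [[h [h0 he]]|triv] := pselect (exists h : C1 G R, codiff h = 0 /\ h e != 0); last first.
  exists 1%N, 0; split=> // [|w w0].
    by apply/cycleP => p; rewrite big1 // => f _; rewrite [X in _ * X]ffunE mulr0.
  rewrite big1 => [|f _]; last by rewrite ffunE !mul0r.
  have [->|we] := eqVneq (w e) 0; first by rewrite mulr0 mul0r.
  by case: triv; exists w.
have [M [maxM /andP[_ /fintype.subsetP KM]]] :=
  maximal_two_connected_above (block_two_connected h0 he).
apply: commensurable_torsion => f fK.
exact: (comm M maxM (Sub f (KM _ fK)) (Sub e (KM _ (mem_block e)))).
Qed.
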